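(* Let $A\in\mathscr R$ be a fixed set and let $\mathbf X^{(1)},\mathbf X^{(2)}$ be independent random vectors in $[0,\infty)^d$ with distributions $F_1,F_2\in\mathcal L_A$ respectively. Then $F_A^{(1)}*F_A^{(2)}\in\mathcal S$ if and only if $F_1*F_2\in\mathcal S_A$.
   Context: Fix an integer $d\ge 1$. $\mathscr R$ is the family of nonempty sets $A\subsetneq\mathbb R^d$ that are open, increasing (if $\mathbf x\in A$ and $\mathbf a\in[0,\infty)^d$ then $\mathbf x+\mathbf a\in A$), have convex complement $A^c$, and satisfy $\mathbf 0\notin\overline A$ (closure). For a random vector $\mathbf X$ in $[0,\infty)^d$ with distribution $F$ put $Y_A:=\sup\{u>0:\mathbf X\in uA\}$ (with $\sup\emptyset=0$), and let $F_A$ be the distribution of $Y_A$; its tail is $\overline F_A(x)=\mathbf P[Y_A>x]=\mathbf P[\mathbf X\in xA]$ for $x>0$. For $i=1,2$, $Y_A^{(i)}:=\sup\{u>0:\mathbf X^{(i)}\in uA\}$ and $F_A^{(i)}$ is its distribution; $F_A^{(1)}*F_A^{(2)}$ is the (one-dimensional) convolution, i.e. the distribution of $Y_A^{(1)}+Y_A^{(2)}$. For a distribution $V$ on $[0,\infty)$ write $\overline V=1-V$ and assume $\overline V(x)>0$ for all $x\ge0$. $V\in\mathcal L$ if $\lim_{x\to\infty}\overline V(x-y)/\overline V(x)=1$ for every (equivalently, some) $y>0$. $V\in\mathcal S$ (subexponential) if $\lim_{x\to\infty}\overline{V^{n*}}(x)/\overline V(x)=n$ for every (equivalently, some) integer $n\ge2$,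 $V^{n*}$ being the $n$-fold convolution. For $\mathcal B\in\{\mathcal L,\mathcal S\}$, $F\in\mathcal B_A$ means $F_A\in\mathcal B$. $F_1*F_2$ is the distribution of $\mathbf X^{(1)}+\mathbf X^{(2)}$, and $F_1*F_2\in\mathcal S_A$ means that the distribution of $\sup\{u>0:\mathbf X^{(1)}+\mathbf X^{(2)}\in uA\}$ is in $\mathcal S$. *)

(* Defs.v *)
From HB Require Import structures.
From mathcomp Require Import all_boot all_order all_algebra.
From mathcomp Require Import all_classical all_reals all_analysis.
From mathcomp Require Import measurable_realfun.
Set Implicit Arguments.
Unset Strict Implicit.
Unset Printing Implicit Defensive.
Import Order.TTheory GRing.Theory Num.Theory.
Import numFieldNormedType.Exports.
Local Open Scope classical_set_scope.
Local Open Scope ring_scope.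

(* Row vectors carry the Borel sigma-algebra of their (product) topology. *)
Definition borel_rV_display : measure_display. Proof. exact. Qed.

Section borel_rV.
Context {R : realType} {d : nat}.

Definition borel_rV : set (set 'rV[R]_d) := <<s @open 'rV[R]_d >>.

Let borel_rV0 : borel_rV set0.
Proof. exact: sigma_algebra0. Qed.

Let borel_rVC (B : set 'rV[R]_d) : borel_rV B -> borel_rV (~` B).
Proof. exact: sigma_algebraC. Qed.

Let borel_rV_bigcup (B : (set 'rV[R]_d)^nat) :
  (forall i, borel_rV (B i)) -> borel_rV (\bigcup_i B i).
Proof. exact: sigma_algebra_bigcup. Qed.

HB.instance Definition _ := @isMeasurable.Build borel_rV_display 'rV[R]_d
  borel_rV borel_rV0 borel_rVC borel_rV_bigcup.

Lemma open_measurable_rV (U : set 'rV[R]_d) : open U -> measurable U.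
Proof. by move=> oU; exact: sub_sigma_algebra. Qed.

Lemma measurable_coord (i : 'I_d) :
  measurable_fun [set: 'rV[R]_d] (fun x : 'rV[R]_d => x 0 i).
Proof.
apply: (measurability _ (RGenOInfty.measurableE R)).
move=> _ [_ [x ->] <-]; rewrite setTI; apply: open_measurable_rV.
by apply: open_comp => [y _|]; [exact: coord_continuous|exact: interval_open].
Qed.

Lemma measurable_fun_rV d0 (T : measurableType d0) (f : T -> 'rV[R]_d) :
  (forall i, measurable_fun setT (fun t => f t 0 i)) -> measurable_fun setT f.
Proof.
move=> mf; apply: (measurability (@open 'rV[R]_d)) => //.
move=> _ [U oU <-]; rewrite setTI.
pose box (q : {ffun 'I_d -> rat * rat}) := [set x : 'rV[R]_d |
  forall i, x 0 i \in `](ratr (q i).1 : R), ratr (q i).2[].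
have UE : U = \bigcup_q (if `[< box q `<=` U >] then box q else set0).
  apply/seteqP; split=> [x Ux|x [q _]]; last first.
    by case: asboolP => // bU /bU.
  have /nbhs_ballP[e /= e0 xeU] : nbhs x U by exact: open_nbhs_nbhs.
  have qP i : exists q : rat * rat,
      x 0 i - e < ratr q.1 < x 0 i /\ x 0 i < ratr q.2 < x 0 i + e.
    have [q1] : exists q, ratr q \in `]x 0 i - e, x 0 i[.
      by apply: rat_in_itvoo; rewrite gtrBl.
    rewrite in_itv/= => q1P.
    have [q2] : exists q, ratr q \in `]x 0 i, x 0 i + e[.
      by apply: rat_in_itvoo; rewrite ltrDl.
    by rewrite in_itv/= => q2P; exists (q1, q2).
  pose q := [ffun i => sval (cid (qP i))].
  have qI i : x 0 i - e < ratr (q i).1 < x 0 i /\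
      x 0 i < ratr (q i).2 < x 0 i + e by rewrite ffunE; case: cid.
  exists q => //; case: asboolP => [_ i|[]].
    by have [/andP[_ ?] /andP[? _]] := qI i; rewrite in_itv/=; apply/andP.
  move=> y qy; apply: xeU; split=> [] // k i; rewrite ord1.
  have [/andP[q1 _] /andP[_ q2]] := qI i.
  have := qy i; rewrite in_itv/= => /andP[y1 y2].
  rewrite /ball/= distrC ltr_distl; apply/andP; split.
    exact: lt_trans q1 y1.
  exact: lt_trans y2 q2.
rewrite UE preimage_bigcup; apply: countable_bigcupT_measurable => [|q].
  exact: countableP.
case: asboolP => // _; last by rewrite preimage_set0.
have -> : f @^-1` box q = \bigcap_(i in [set: 'I_d])
    ((fun t => f t 0 i) @^-1` `](ratr (q i).1 : R), ratr (q i).2[).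
  by apply/seteqP; split => [t bt i _|t bt i]; [exact: bt|exact: (bt i)].
apply: fin_bigcap_measurable => // i _.
by rewrite -[X in measurable X]setTI; apply: mf.
Qed.

End borel_rV.

Section random_vectors.
Context {R : realType} {d : nat} {d0 : measure_display}
  {Omega : measurableType d0} {P : probability Omega R}.

Definition add_rv (X1 X2 : {RV P >-> 'rV[R]_d}) : Omega -> 'rV[R]_d :=
  fun w => X1 w + X2 w.

Let measurable_add_rv X1 X2 : measurable_fun setT (add_rv X1 X2).
Proof.
apply: measurable_fun_rV => i.
rewrite (_ : (fun _ => _) = (fun w => X1 w 0 i) \+ (fun w => X2 w 0 i)).
  by apply: measurable_funD; apply: (measurableT_comp (measurable_coord i)).
by apply/funext => w; rewrite /add_rv mxE.
Qed.

HB.instance Definition _ X1 X2 :=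
  isMeasurableFun.Build _ _ _ _ (add_rv X1 X2) (measurable_add_rv X1 X2).

Definition independent_rv (X1 X2 : {RV P >-> 'rV[R]_d}) :=
  forall B1 B2 : set 'rV[R]_d, measurable B1 -> measurable B2 ->
    P (X1 @^-1` B1 `&` X2 @^-1` B2) = (P (X1 @^-1` B1) * P (X2 @^-1` B2))%E.

End random_vectors.

Section ruin_sets.
Context {R : realType} {d : nat}.

Definition in_orthant (x : 'rV[R]_d) := forall i, 0 <= x 0 i.

Definition increasing_set (A : set 'rV[R]_d) :=
  forall x a, A x -> in_orthant a -> A (x + a).

Definition scrR : set (set 'rV[R]_d) := [set A |
  [/\ A !=set0 /\ A `<` setT, open A, increasing_set A,
      convex_set (~` A) & ~ closure A 0]].

Definition dilate (u : R) (A : set 'rV[R]_d) : set 'rV[R]_d :=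
  [set u *: a | a in A].

(* The real supremum is total, with [sup set0 = 0] and [sup S = 0] for [S]
   unbounded above; the latter never occurs for [A] in [scrR] ([Yset_ubound]),
   since [0] is not in the closure of [A]. *)
Definition Yfun (A : set 'rV[R]_d) (x : 'rV[R]_d) : R :=
  sup [set u : R | 0 < u /\ dilate u A x].

Lemma Yset_ubound A x : scrR A -> has_ubound [set u : R | 0 < u /\ dilate u A x].
Proof.
move=> [_ _ _ _ A0].
have /existsNP[B /not_implyP[/nbhs_ballP[e /= e0 eB] AB]] := A0.
pose M := (1 + \sum_(i < d) `|x 0 i|) / e.
exists M => u [u0 [a Aa uax]]; rewrite leNgt; apply/negP => Mu.
apply: AB; exists a; split=> //; apply: eB; split=> // k i; rewrite ord1.
rewrite /ball/= mxE sub0r normrN -(ltr_pM2l u0).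
have -> : u * `|a 0 i| = `|x 0 i| by rewrite -uax mxE normrM gtr0_norm.
apply: (@lt_le_trans _ _ (M * e)); last by rewrite ler_pM2r// ltW.
rewrite /M mulfVK ?gt_eqF// (bigD1 i)//= addrCA ltrDl.
by rewrite ltr_pwDl// sumr_ge0.
Qed.

Lemma Yfun_ge0 A x : scrR A -> 0 <= Yfun A x.
Proof.
move=> AR; rewrite /Yfun; set S := [set u | _].
have [->|/set0P[u Su]] := eqVneq S set0; first by rewrite sup0.
apply: (@le_trans _ _ u); first by case: Su => /ltW.
by apply: ub_le_sup => //; exact: Yset_ubound.
Qed.

Lemma dilate_open u A : 0 < u -> open A -> open (dilate u A).
Proof.
move=> u0 oA.
have -> : dilate u A = ( *:%R u^-1) @^-1` A.
  apply/seteqP; split=> [_ [a Aa <-]|x Ax] /=.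
    by rewrite scalerA mulVf ?gt_eqF// scale1r.
  by exists (u^-1 *: x) => //; rewrite scalerA divff ?gt_eqF// scale1r.
by apply: open_comp => // y _; exact: scaler_continuous.
Qed.

Lemma measurable_Yfun A : scrR A -> measurable_fun setT (Yfun A).
Proof.
move=> AR; have [_ oA _ _ _] := AR.
apply: (measurability _ (RGenOInfty.measurableE R)).
move=> _ [_ [t ->] <-]; rewrite setTI; apply: open_measurable_rV.
have [t0|t0] := ltP t 0.
  rewrite (_ : _ @^-1` _ = setT); first exact: openT.
  apply/seteqP; split=> // x _ /=; rewrite in_itv/= andbT (lt_le_trans t0)//.
  exact: Yfun_ge0.
rewrite (_ : _ @^-1` _ = \bigcup_(u in [set u | t < u]) dilate u A); last first.
  apply/seteqP; split=> [x|x [u /= tu ux]]; rewrite /= in_itv/= andbT.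
    rewrite /Yfun; set S := [set u | _].
    have [->|/set0P S0] := eqVneq S set0; first by rewrite sup0 ltNge t0.
    by move=> /(sup_gt S0)[u [_ ux] tu]; exists u.
  apply: (lt_le_trans tu); apply: ub_le_sup; first exact: Yset_ubound.
  by split=> //; exact: le_lt_trans tu.
apply: bigcup_open => u /= tu.
by apply: dilate_open => //; exact: le_lt_trans tu.
Qed.

Record rare_set := RareSet {
  rare_car :> set 'rV[R]_d ;
  rare_carP : scrR rare_car }.

(* [YA A \o X] is the random variable Y_A of the random vector [X]. *)
Definition YA (A : rare_set) : 'rV[R]_d -> R := Yfun A.

HB.instance Definition _ (A : rare_set) :=
  isMeasurableFun.Build _ _ _ _ (YA A) (measurable_Yfun (rare_carP A)).

(* F_A *)
Definition law_at (A : rare_set) (F : probability 'rV[R]_d R) :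
  probability R R := distribution F (YA A).

End ruin_sets.
Arguments rare_set : clear implicits.

Section distribution_classes.
Context {R : realType}.
Implicit Types V W : probability R R.

Definition add_pair (p : R * R) : R := p.1 + p.2.

Let measurable_add_pair : measurable_fun setT add_pair.
Proof. exact: measurable_funD. Qed.

HB.instance Definition _ :=
  isMeasurableFun.Build _ _ _ _ add_pair measurable_add_pair.

Definition convolution V W : probability R R := distribution (V \x W)%E add_pair.

(* V^{n*} for n >= 1 *)
Definition convolution_pow V n : probability R R := iter n.-1 (convolution V) V.

Definition tail V (x : R) : R := fine (V `]x, +oo[%classic).

Definition halfline_full_tail V :=
  V `[0, +oo[%classic = 1%E /\ forall x, 0 <= x -> 0 < tail V x.

Definition long_tailed : set (probability R R) := [set V |
  halfline_full_tail V /\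
  forall y, 0 < y -> tail V (x - y) / tail V x @[x --> +oo] --> (1 : R)].

Definition subexponential : set (probability R R) := [set V |
  halfline_full_tail V /\
  forall n, (2 <= n)%N ->
    tail (convolution_pow V n) x / tail V x @[x --> +oo] --> (n%:R : R)].

(* The multivariate class B_A attached to a class B of laws on the line. *)
Definition class_at d (B : set (probability R R)) (A : rare_set R d) :
  set (probability 'rV[R]_d R) := [set F | B (law_at A F)].

End distribution_classes.

(* Main.v *)
Require Import Defs.
From HB Require Import structures.
From mathcomp Require Import all_boot all_order all_algebra.
From mathcomp Require Import all_classical all_reals all_analysis.
From mathcomp Require Import ring lra.
Set Implicit Arguments.
Unset Strict Implicit.
Unset Printing Implicit Defensive.
Import Order.TTheory GRing.Theory Num.Theory.
Import numFieldNormedType.Exports.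
Local Open Scope classical_set_scope.
Local Open Scope ring_scope.

(** The functional Y_A is dominated by a sum and dominates a maximum.  Since
    A is increasing, Y_A (x + y) >= max (Y_A x) (Y_A y) for x, y in the orthant
    ([Yfun_monotone]); since the complement of A is convex, Y_A is subadditive
    ([Yfun_subadditive]).  Write V, W for the laws of Y_A (X1), Y_A (X2), with
    tails v, w, let G be the tail of V * W, and let z be the tail of
    Y_A (X1 + X2).  By independence
      v + w - v w <= z <= G,
    and G itself also lies between these two bounds.  So both directions are
    one and the same claim ([subexponential_sandwich]): if u and u' are two
    tails between v + w - v w and G, and u is subexponential, so is u'.

    The claim rests on the principle of one big jump ([one_big_jump]):
    G - (v + w) = o(u) as soon as V and W are long-tailed and v, w = O(u).  If
    a sum Y1 + Y2 exceeds x, then one summand exceeds x - K, which by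
    long-tailedness costs about v + w, or both summands exceed K.  The
    probability of the latter event only increases, up to a constant, when V
    and W are replaced by U ([joint_tail_le]), and for two independent
    variables of law U it is at most P(U1 + U2 > x) - 2 u(x) (1 - u(K))
    ([joint_tail_self]), whose ratio to u(x) tends to 2 u(K), which is
    arbitrarily small for large K.

    As v w = o(u), the bounds v + w - v w and G are equivalent, hence so are u,
    u' and v + w.  In particular u is long-tailed because v + w is, and
    another use of the one big jump, by induction on the convolution power,
    transfers subexponentiality from u to the equivalent tail u'
    ([subexponential_equiv]). *)

(** * The functional Y_A *)

Section geometry.
Context {R : realType} {d : nat}.
Implicit Types (A : set 'rV[R]_d) (x y : 'rV[R]_d).

Lemma Yfun_ge A x u : scrR A -> 0 < u -> dilate u A x -> u <= Yfun A x.
Proof. by move=> AR u0 ux; apply: ub_le_sup => //; exact: Yset_ubound. Qed.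

Lemma Yfun_le A x b : scrR A -> 0 <= b ->
  (forall u, 0 < u -> dilate u A x -> u <= b) -> Yfun A x <= b.
Proof.
move=> AR b0 ub; rewrite /Yfun; set S := [set u | _].
have [->|/set0P S0] := eqVneq S set0; first by rewrite sup0.
by apply: ge_sup => // u [u0]; exact: ub.
Qed.

(** If x = u a with a in A, then x + y = u (a + y / u), and adding the
    nonnegative vector y / u does not leave the increasing set A. *)
Lemma Yfun_monotone A x y : scrR A -> in_orthant y ->
  Yfun A x <= Yfun A (x + y).
Proof.
move=> AR y0; have [_ _ incA _ _] := AR.
apply: Yfun_le => [//||u u0 [a Aa <-]]; first exact: Yfun_ge0.
apply: Yfun_ge => //; exists (a + u^-1 *: y).
  by apply: incA => // i; rewrite mxE mulr_ge0// invr_ge0 ltW.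
by rewrite scalerDr scalerA mulfV ?gt_eqF// scale1r.
Qed.

(** If s > Y_A x and t > Y_A y, then x / s and y / t lie in the convex
    complement of A, hence so does (x + y) / (s + t), their convex combination
    with weights s / (s + t) and t / (s + t). *)
Lemma Yfun_subadditive A x y : scrR A ->
  Yfun A (x + y) <= Yfun A x + Yfun A y.
Proof.
move=> AR; have [_ _ _ convA _] := AR.
have Y0 z : 0 <= Yfun A z by exact: Yfun_ge0.
apply: Yfun_le => [//||u u0 [a Aa uaxy]]; first exact: addr_ge0.
rewrite leNgt; apply/negP => Yu.
(* The gap is split evenly: s and t must exceed Y_A x and Y_A y strictly. *)
pose e := (u - (Yfun A x + Yfun A y)) / 2.
have e0 : 0 < e by rewrite divr_gt0// subr_gt0.
pose s := Yfun A x + e; pose t := Yfun A y + e.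
have s0 : 0 < s by rewrite ltr_wpDl.
have t0 : 0 < t by rewrite ltr_wpDl.
have stu : s + t = u by rewrite /s /t /e; field.
have out z r : 0 < r -> Yfun A z < r -> (~` A) (r^-1 *: z).
  move=> r0 zr Az; move: zr; apply/negP; rewrite -leNgt.
  apply: Yfun_ge => //; exists (r^-1 *: z) => //.
  by rewrite scalerA mulfV ?gt_eqF// scale1r.
have xs : (~` A) (s^-1 *: x) by apply: out => //; rewrite ltrDl.
have yt : (~` A) (t^-1 *: y) by apply: out => //; rewrite ltrDl.
have l0 : 0 <= s / u by rewrite divr_ge0// ltW.
have l1 : s / u <= 1 by rewrite ler_pdivrMr// mul1r -stu lerDl ltW.
have := convA _ _ (Itv01 l0 l1) (mem_set xs) (mem_set yt).
rewrite inE /conv/= /unstable.onem !scalerA.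
have -> : s / u / s = u^-1 by field; rewrite !gt_eqF.
have -> : (1 - s / u) / t = u^-1 by rewrite -stu; field; rewrite stu !gt_eqF.
by rewrite -scalerDr -uaxy scalerA mulVf ?gt_eqF// scale1r; apply.
Qed.

End geometry.

(** * Tails of convolutions *)

Section laws_on_the_line.
Context {R : realType}.
Implicit Types (V W U : probability R R) (K x : R).

Lemma tailE V x : (tail V x)%:E = V `]x, +oo[%classic.
Proof. by rewrite /tail fineK// fin_num_measure. Qed.

Lemma tail_ge0 V x : 0 <= tail V x.
Proof. exact: fine_ge0. Qed.

Lemma tail_le1 V x : tail V x <= 1.
Proof. by rewrite -lee_fin tailE probability_le1. Qed.

Lemma tail_cvg0 V : tail V x @[x --> +oo] --> (0 : R).
Proof.
pose X : {mfun R >-> R} :=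
  HB.pack (@idfun R) (isMeasurableFun.Build _ _ _ _ _ (@measurable_id _ R setT)).
apply: fine_cvg; have := cvg_ccdfy0 (X : {RV V >-> R}).
by rewrite /ccdf /distribution /pushforward.
Qed.

Definition sum_gt x : set (R * R) := [set p | x < p.1 + p.2].
Definition both_large K x : set (R * R) :=
  [set p | [/\ K < p.1, K < p.2 & x < p.1 + p.2]].

Lemma tail_convolutionE V W x :
  (tail (convolution V W) x)%:E = (V \x W)%E (sum_gt x).
Proof.
rewrite tailE /convolution /distribution/= /pushforward; congr (_ _).
by apply/seteqP; split => p; rewrite /sum_gt /= in_itv/= andbT.
Qed.

Lemma measurable_sum_gt x : measurable (sum_gt x).
Proof.
have := measurable_funPT (@Defs.add_pair R) measurableT
  `]x, +oo[%classic (measurable_itv _).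
rewrite setTI; congr measurable.
by apply/seteqP; split => p; rewrite /sum_gt /= in_itv/= andbT.
Qed.

Lemma measurable_both_large K x : measurable (both_large K x).
Proof.
rewrite (_ : both_large K x =
  (`]K, +oo[%classic `*` `]K, +oo[%classic) `&` sum_gt x).
  by apply: measurableI; [exact: measurableX|exact: measurable_sum_gt].
apply/seteqP; split => p; rewrite /both_large /sum_gt /= !in_itv/= !andbT.
  by case.
by case=> -[].
Qed.

Lemma both_largeC V W K x :
  ((V \x W) (both_large K x) = (W \x V) (both_large K x))%E.
Proof.
pose sw : {mfun (R * R)%type >-> (R * R)%type} :=
  HB.pack (@unstable.swap R R)
    (isMeasurableFun.Build _ _ _ _ _ (@measurable_swap _ _ R R)).
have swE (A B : set R) : measurable A -> measurable B ->
    (distribution (W \x V) sw (A `*` B) = V A * W B)%E.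
  move=> mA mB; rewrite muleC -product_measure1E//.
  rewrite /distribution/= /pushforward; congr (_ _).
  by apply/seteqP; split=> p [].
rewrite (product_measure_unique swE); last exact: measurable_both_large.
rewrite /distribution/= /pushforward; congr (_ _).
by apply/seteqP; split=> p [? ? ?]; split=> //=; rewrite addrC.
Qed.

(** Conditionally on the first coordinate p.1 = y > K, the event says that the
    second one exceeds max K (x - y).  This level is at least K, which is why
    the tails need to be compared only beyond K. *)
Lemma both_large_le_r V W U C K x : 0 <= C ->
  (forall y, K <= y -> tail W y <= C * tail U y) ->
  ((V \x W) (both_large K x) <= C%:E * (V \x U) (both_large K x))%E.
Proof.
move=> C0 WU; rewrite /product_measure1.
have mB := measurable_both_large K x.
rewrite -ge0_integralZl//; last exact: measurable_fun_xsection.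
apply: ge0_le_integral => //.
- exact: measurable_fun_xsection.
- by apply: measurable_funeM; exact: measurable_fun_xsection.
move=> y _ /=.
have [Ky|yK] := ltP K y; last first.
  rewrite (_ : xsection _ y = set0) ?measure0 ?mule0//.
  by apply/seteqP; split=> // z; rewrite /xsection/= inE => -[/=]; rewrite ltNge yK.
rewrite (_ : xsection _ y = `]Num.max K (x - y), +oo[%classic).
  by rewrite -!tailE -EFinM lee_fin WU// le_max lexx.
apply/seteqP; split=> z;
  rewrite /xsection/= inE /both_large/= in_itv/= andbT gt_max ltrBlDl.
  by case=> _ -> ->.
by case/andP.
Qed.

End laws_on_the_line.

Section joint_tails.
Context {R : realType}.
Implicit Types (V W U : probability R R) (K x : R).

Definition joint_tail V W K x : R := fine ((V \x W)%E (both_large K x)).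

Lemma joint_tailE V W K x :
  (joint_tail V W K x)%:E = (V \x W)%E (both_large K x).
Proof.
rewrite /joint_tail fineK//.
apply: (@fin_num_measure _ _ _ ((V \x W)%E : probability (R * R)%type R)).
exact: measurable_both_large.
Qed.

(** The two factors are replaced one at a time, with an exchange of the
    coordinates in between. *)
Lemma joint_tail_le V W U C K x : 0 <= C ->
  (forall y, K <= y -> tail V y <= C * tail U y) ->
  (forall y, K <= y -> tail W y <= C * tail U y) ->
  joint_tail V W K x <= C * C * joint_tail U U K x.
Proof.
move=> C0 VU WU; rewrite -lee_fin !EFinM !joint_tailE -muleA.
apply: (le_trans (both_large_le_r _ _ C0 WU)).
by rewrite lee_wpmul2l// both_largeC both_large_le_r.
Qed.

Lemma halfline_itv V K : V `[0, +oo[%classic = 1%E -> 0 <= K ->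
  V `[0, K]%classic = (1 - tail V K)%:E.
Proof.
move=> V1 K0; rewrite EFinB tailE -V1.
have -> : `[0, +oo[%classic = `[0, K]%classic `|` `]K, +oo[%classic :> set R.
  by rewrite -itv_bndbnd_setU// bnd_simp.
rewrite measureU//; first by rewrite addeK// fin_num_measure.
apply/seteqP; split=> // z/=; rewrite !in_itv/= andbT => -[/andP[_]].
by rewrite leNgt => /negbTE ->.
Qed.

(** If one of the coordinates is at most K, then the other one must exceed
    x - K. *)
Lemma tail_convolution_le V W K x :
  tail (convolution V W) x <=
  tail V (x - K) + tail W (x - K) + joint_tail V W K x.
Proof.
rewrite -lee_fin !EFinD joint_tailE tail_convolutionE.
have mB := measurable_both_large K x.
have VE : ((V \x W) (`](x - K)%R, +oo[ `*` setT) = (tail V (x - K))%:E)%E.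
  by rewrite product_measure1E// tailE -[RHS]mule1; congr (_ * _)%E;
    exact: probability_setT.
have WE : ((V \x W) (setT `*` `](x - K)%R, +oo[) = (tail W (x - K))%:E)%E.
  by rewrite product_measure1E// tailE -[RHS]mul1e; congr (_ * _)%E;
    exact: probability_setT.
rewrite -VE -WE; set A := _ `*` _; set B := _ `*` _.
have mA : measurable A by exact: measurableX.
have mB' : measurable B by exact: measurableX.
apply: (@le_trans _ _ ((V \x W)%E (A `|` B `|` both_large K x))).
  apply: le_measure; rewrite ?inE//; first exact: measurable_sum_gt.
    by apply: measurableU => //; exact: measurableU.
  move=> p; rewrite /sum_gt /both_large /A /B /= !in_itv/= !andbT => xp.
  have [Kp1|p1K] := ltP K p.1; last by left; right; split=> //; lra.
  have [Kp2|p2K] := ltP K p.2; first by right.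
  by left; left; split=> //; lra.
apply: (le_trans (measureU2 _ _ _)) => //; first exact: measurableU.
by apply: leeD => //; exact: measureU2.
Qed.

(** The restriction to the quadrant makes this event a subset of [sum_gt x];
    it loses no mass for laws on the half-line. *)
Definition max_gt x : set (R * R) :=
  [set p | [/\ 0 <= p.1, 0 <= p.2 & x < Num.max p.1 p.2]].

Lemma max_gtE x : 0 <= x -> max_gt x =
  `]x, +oo[%classic `*` `[0, +oo[%classic `|`
  `[0, x]%classic `*` `]x, +oo[%classic.
Proof.
move=> x0; apply/seteqP; split=> p.
  case=> p1 p2; rewrite /= !in_itv/= !andbT p1 p2 lt_max.
  by have [|] := ltP x p.1; [left|right].
rewrite /max_gt /= !in_itv/= !andbT lt_max.
case=> [[xp p0]|[/andP[p0 _] xp]]; split=> //; rewrite ?xp ?orbT//; lra.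
Qed.

Lemma measurable_max_gt x : 0 <= x -> measurable (max_gt x).
Proof. by move=> x0; rewrite max_gtE//; apply: measurableU; exact: measurableX. Qed.

Lemma product_max_gt V W x :
  V `[0, +oo[%classic = 1%E -> W `[0, +oo[%classic = 1%E -> 0 <= x ->
  (V \x W)%E (max_gt x) =
  (tail V x + tail W x - tail V x * tail W x)%:E.
Proof.
move=> V1 W1 x0.
have -> : tail V x + tail W x - tail V x * tail W x =
  tail V x * 1 + (1 - tail V x) * tail W x by ring.
rewrite EFinD !EFinM -W1 -halfline_itv// !tailE -!product_measure1E//.
rewrite -measureU//; first by rewrite max_gtE.
- exact: measurableX.
- exact: measurableX.
- apply/seteqP; split=> // p [] [/= + _] [/= + _].
  by rewrite !in_itv/= andbT => xp /andP[_]; rewrite leNgt xp.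
Qed.

Lemma tail_convolution_ge V W x :
  V `[0, +oo[%classic = 1%E -> W `[0, +oo[%classic = 1%E -> 0 <= x ->
  tail V x + tail W x - tail V x * tail W x <= tail (convolution V W) x.
Proof.
move=> V1 W1 x0; rewrite -lee_fin tail_convolutionE -product_max_gt//.
apply: le_measure; rewrite ?inE//.
- exact: measurable_max_gt.
- exact: measurable_sum_gt.
by move=> p [p1 p2]; rewrite lt_max /sum_gt/= => /orP[|]; lra.
Qed.

(** Besides the event that both coordinates exceed K, the event that the sum
    exceeds x contains the two disjoint events that one coordinate exceeds x
    while the other one lies in [0, K]. *)
Lemma joint_tail_self V K x : V `[0, +oo[%classic = 1%E -> 0 <= K -> K <= x ->
  joint_tail V V K x <=
  tail (convolution V V) x - 2 * tail V x * (1 - tail V K).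
Proof.
move=> V1 K0 Kx.
rewrite lerBrDr -lee_fin tail_convolutionE.
have -> : joint_tail V V K x + 2 * tail V x * (1 - tail V K) =
  joint_tail V V K x + (tail V x * (1 - tail V K) + (1 - tail V K) * tail V x).
  by ring.
rewrite !EFinD !EFinM -halfline_itv// !tailE joint_tailE -!product_measure1E//.
have mI : measurable `]x, +oo[%classic by exact: measurable_itv.
rewrite -measureU//; last 3 first.
- exact: measurableX.
- exact: measurableX.
- apply/seteqP; split=> // p [] [/= + _] [/= + _].
  by rewrite !in_itv/= andbT => xp /andP[_]; lra.
rewrite -measureU//; last 3 first.
- exact: measurable_both_large.
- by apply: measurableU; exact: measurableX.
- apply/seteqP; split=> // p [] [/= K1 K2 _].
  by rewrite /= !in_itv/= andbT => -[[_ /andP[_]]|[/andP[_ +] _]]; lra.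
apply: le_measure; rewrite ?inE//.
- apply: measurableU; first exact: measurable_both_large.
  by apply: measurableU; exact: measurableX.
- exact: measurable_sum_gt.
move=> p; rewrite /sum_gt /= !in_itv/= !andbT.
by move=> -[[]//|[[xp /andP[p0 _]]|[/andP[p0 _] xp]]]; lra.
Qed.

Lemma convolution_halfline_full V W :
  halfline_full_tail V -> halfline_full_tail W ->
  halfline_full_tail (convolution V W).
Proof.
move=> [V1 V0] [W1 W0]; split.
  apply/eqP; rewrite eq_le probability_le1//=.
  rewrite -[leLHS]mule1 -{1}V1 -W1 -product_measure1E//.
  rewrite /convolution /distribution/= /pushforward.
  apply: le_measure; rewrite ?inE//; first exact: measurableX.
    rewrite -[X in measurable X]setTI.
    exact: (measurable_funPT (@Defs.add_pair R)).
  move=> p [] /=; rewrite !in_itv/= !andbT; exact: addr_ge0.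
move=> x x0; apply: lt_le_trans (tail_convolution_ge V1 W1 x0).
rewrite -addrA ltr_wpDr ?V0// -[X in X - _]mul1r -mulrBl mulr_ge0 ?tail_ge0//.
by rewrite subr_ge0 tail_le1.
Qed.

End joint_tails.

(** * Long-tailed functions *)

Section long_functions.
Context {R : realType}.
Implicit Types f g : R -> R.

Definition long_function f :=
  forall y, 0 < y -> f (x - y) / f x @[x --> +oo] --> (1 : R).

Lemma cvg_shift_pinfty (y : R) : x - y @[x --> +oo] --> +oo.
Proof.
apply/cvgryPge => A; near=> x.
by rewrite lerBrDr; near: x; apply: nbhs_pinfty_ge; exact: num_real.
Unshelve. all: by end_near. Qed.

(** Write g (x - y) / g x as the product of g (x - y) / f (x - y),
    f (x - y) / f x and the inverse of g x / f x: the first and the last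
    factor have inverse limits. *)
Lemma long_function_equiv f g (c : R) :
  (\forall x \near +oo, 0 < f x) -> (\forall x \near +oo, 0 < g x) -> c != 0 ->
  g x / f x @[x --> +oo] --> c -> long_function f -> long_function g.
Proof.
move=> f0 g0 c0 gf lf y y0.
have gfy : g (x - y) / f (x - y) @[x --> +oo] --> c.
  exact: cvg_comp (cvg_shift_pinfty y) gf.
have f0y : \forall x \near +oo, 0 < f (x - y) by exact: (cvg_shift_pinfty y f0).
have lim1 : g (x - y) / f (x - y) * (f (x - y) / f x) / (g x / f x)
    @[x --> +oo] --> c * 1 / c.
  by apply: cvgM; [apply: cvgM => //; exact: lf|exact: cvgV].
rewrite mulr1 divff// in lim1.
apply: cvg_trans lim1; apply: near_eq_cvg; near=> x.
have fx : f x != 0 by rewrite gt_eqF//; near: x.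
have gx : g x != 0 by rewrite gt_eqF//; near: x.
have fxy : f (x - y) != 0 by rewrite gt_eqF//; near: x.
by rewrite /=; field; rewrite fx gx fxy.
Unshelve. all: by end_near. Qed.

Lemma long_functionD f g :
  (forall x, 0 <= x -> 0 < f x) -> (forall x, 0 <= x -> 0 < g x) ->
  long_function f -> long_function g -> long_function (f \+ g).
Proof.
move=> f0 g0 lf lg y y0; apply/cvgrPdist_le => e e0; near=> x.
have x0 : 0 <= x by near: x; apply: nbhs_pinfty_ge; exact: num_real.
have fx := f0 _ x0; have gx := g0 _ x0.
have bd h : 0 < h x -> `|1 - h (x - y) / h x| <= e ->
    `|h x - h (x - y)| <= e * h x.
  move=> hx; rewrite -[X in `|X - _|](divff (lt0r_neq0 hx)) -mulrBl normrM.
  by rewrite normfV (gtr0_norm hx) ler_pdivrMr.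
have fe : `|f x - f (x - y)| <= e * f x.
  by apply: bd => //; near: x; move/cvgrPdist_le : (lf y y0); exact.
have ge : `|g x - g (x - y)| <= e * g x.
  by apply: bd => //; near: x; move/cvgrPdist_le : (lg y y0); exact.
have h0 : 0 < f x + g x by exact: addr_gt0.
rewrite /= -[X in `|X - _|](divff (lt0r_neq0 h0)) -mulrBl normrM normfV.
rewrite (gtr0_norm h0) ler_pdivrMr// opprD addrACA mulrDr.
by rewrite (le_trans (ler_normD _ _))// lerD.
Unshelve. all: by end_near. Qed.

End long_functions.

(** * The principle of one big jump *)

Section one_big_jump.
Context {R : realType}.
Implicit Types (V W U : probability R R).

Lemma tail_near_gt0 V : halfline_full_tail V -> \forall x \near +oo, 0 < tail V x.
Proof.
move=> [_ V0]; near=> x; apply: V0; near: x; apply: nbhs_pinfty_ge; exact: num_real.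
Unshelve. all: by end_near. Qed.

(** This is the only place where the limit 2 of the ratio of the tails of U * U
    and U is used: in [joint_tail_self] it cancels the term 2 u(x), and what
    remains is of order u(K) u(x). *)
Lemma joint_tail_small U (e : R) : subexponential U -> 0 < e ->
  \forall K \near +oo, \forall x \near +oo,
    joint_tail U U K x <= e * tail U x.
Proof.
move=> [[U1 U0] sU] e0.
have e4 : 0 < e / 4 by rewrite divr_gt0.
have e2 : 0 < e / 2 by rewrite divr_gt0.
near=> K; near=> x.
have K0 : 0 <= K by near: K; apply: nbhs_pinfty_ge; exact: num_real.
have Kx : K <= x by near: x; apply: nbhs_pinfty_ge; exact: num_real.
have uK : tail U K <= e / 4.
  rewrite -[leLHS]ger0_norm ?tail_ge0// -normrN -[X in `|X|]add0r.
  by near: K; move/cvgrPdist_le : (tail_cvg0 U); exact.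
have ux : 0 < tail U x by apply: U0; exact: le_trans Kx.
have UU : tail (convolution U U) x <= (2 + e / 2) * tail U x.
  rewrite -ler_pdivrMr// -lerBlDl (le_trans (ler_norm _))// distrC.
  by near: x; move/cvgrPdist_le : (sU 2%N isT); exact.
apply: (le_trans (joint_tail_self U1 K0 Kx)).
nra.
Unshelve. all: by end_near. Qed.

(** The error is estimated for a fixed K: the two long-tail errors are at most
    a C u(x) each and the joint tail is at most b C^2 u(x), where the constants
    a and b make each of the three terms at most e / 3 u(x). *)
Lemma one_big_jump V W U (C : R) :
  long_tailed V -> long_tailed W -> subexponential U -> 0 <= C ->
  (\forall x \near +oo, tail V x <= C * tail U x) ->
  (\forall x \near +oo, tail W x <= C * tail U x) ->
  (tail (convolution V W) x - (tail V x + tail W x)) / tail U x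
    @[x --> +oo] --> (0 : R).
Proof.
move=> [Vf lV] [Wf lW] sU C0 VU WU.
apply/cvgrPdist_le => e e0.
pose a := e / (3 * (C + 1)).
pose b := e / (3 * (C + 1) ^+ 2).
have C1 : 0 < C + 1 by rewrite ltr_wpDl.
have a0 : 0 < a by rewrite divr_gt0// mulr_gt0.
have b0 : 0 < b by rewrite divr_gt0// mulr_gt0// exprn_gt0.
have aE : a * (C + 1) = e / 3 by rewrite /a; field; rewrite gt_eqF.
have bE : b * (C + 1) ^+ 2 = e / 3 by rewrite /b; field; rewrite gt_eqF.
have [K [K0 VUK WUK sK]] : exists K, [/\ 0 < K,
    (forall y, K <= y -> tail V y <= C * tail U y),
    (forall y, K <= y -> tail W y <= C * tail U y) &
    \forall x \near +oo, joint_tail U U K x <= b * tail U x].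
  have [M1 [_ hV]] := VU; have [M2 [_ hW]] := WU.
  near (pinfty_nbhs R) => K; exists K; split.
  - by near: K; apply: nbhs_pinfty_gt; exact: num_real.
  - move=> y Ky; apply: hV; apply: lt_le_trans Ky.
    by near: K; apply: nbhs_pinfty_gt; exact: num_real.
  - move=> y Ky; apply: hW; apply: lt_le_trans Ky.
    by near: K; apply: nbhs_pinfty_gt; exact: num_real.
  - by near: K; exact: joint_tail_small.
near=> x.
have x0 : 0 <= x by near: x; apply: nbhs_pinfty_ge; exact: num_real.
have Kx : K <= x by near: x; apply: nbhs_pinfty_ge; exact: num_real.
have [[_ U0] _] := sU.
have ux : 0 < tail U x by exact: U0.
have vx : 0 < tail V x by case: Vf => _; exact.
have wx : 0 < tail W x by case: Wf => _; exact.
have shift Z : 0 < tail Z x -> `|1 - tail Z (x - K) / tail Z x| <= a ->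
    tail Z (x - K) <= (1 + a) * tail Z x.
  move=> zx h; rewrite -ler_pdivrMr// -lerBlDl (le_trans (ler_norm _))//.
  by rewrite distrC.
have vK : tail V (x - K) <= (1 + a) * tail V x.
  by apply: shift => //; near: x; move/cvgrPdist_le : (lV K K0); exact.
have wK : tail W (x - K) <= (1 + a) * tail W x.
  by apply: shift => //; near: x; move/cvgrPdist_le : (lW K K0); exact.
have va : tail V x <= a.
  rewrite -[leLHS]ger0_norm ?tail_ge0// -normrN -[X in `|X|]add0r.
  by near: x; move/cvgrPdist_le : (tail_cvg0 V); exact.
have jK : joint_tail U U K x <= b * tail U x by near: x.
have up := tail_convolution_le V W K x.
have lo := tail_convolution_ge (proj1 Vf) (proj1 Wf) x0.
have jVW := joint_tail_le x C0 VUK WUK.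
have vC := VUK _ Kx; have wC := WUK _ Kx.
rewrite sub0r normrN normrM normfV (gtr0_norm ux) ler_pdivrMr// ler_norml.
have au0 : 0 <= a * tail U x by rewrite mulr_ge0// ltW.
have avC : a * tail V x <= a * (C * tail U x) by rewrite ler_pM2l.
have awC : a * tail W x <= a * (C * tail U x) by rewrite ler_pM2l.
have aEu : a * (C + 1) * tail U x = e / 3 * tail U x by rewrite aE.
have vwa : tail V x * tail W x <= a * (C * tail U x).
  by apply: ler_pM => //; exact: tail_ge0.
have eu : 0 < e * tail U x by exact: mulr_gt0.
(* The lower bound: only the product v w has to be absorbed. *)
apply/andP; split; first lra.
have CC : C * C * joint_tail U U K x <= (C + 1) ^+ 2 * (b * tail U x).
  apply: (@le_trans _ _ (C * C * (b * tail U x))).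
    by rewrite ler_wpM2l// mulr_ge0.
  by apply: ler_wpM2r; [exact/ltW/mulr_gt0|lra].
have bEu : (C + 1) ^+ 2 * (b * tail U x) = e / 3 * tail U x.
  by rewrite mulrA [_ * b]mulrC bE.
lra.
Unshelve. all: by end_near. Qed.

End one_big_jump.

(** * Tail equivalence and the sandwich *)

Section closure.
Context {R : realType}.
Implicit Types (V W U : probability R R).

Lemma ratio_near_le (f g : R -> R) (c C : R) :
  (\forall x \near +oo, 0 < g x) -> f x / g x @[x --> +oo] --> c -> c < C ->
  \forall x \near +oo, f x <= C * g x.
Proof.
move=> g0 fg cC; near=> x.
have gx : 0 < g x by near: x.
rewrite -ler_pdivrMr//; near: x; exact: (cvgr_le c fg C cC).
Unshelve. all: by end_near. Qed.

(** Tails equivalent to a positive multiple of a long tail are long, so the one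
    big jump applies to V and W with u as the reference. *)
Lemma tail_convolution_equiv V W U (a b : R) :
  subexponential U -> long_function (tail U) ->
  halfline_full_tail V -> halfline_full_tail W -> 0 < a -> 0 < b ->
  tail V x / tail U x @[x --> +oo] --> a ->
  tail W x / tail U x @[x --> +oo] --> b ->
  tail (convolution V W) x / tail U x @[x --> +oo] --> a + b.
Proof.
move=> sU lU Vf Wf a0 b0 Va Wb.
have [Uf _] := sU.
have U0 := tail_near_gt0 Uf.
have lV : long_tailed V.
  split=> //; apply: (long_function_equiv U0 (tail_near_gt0 Vf) _ Va lU).
  by rewrite gt_eqF.
have lW : long_tailed W.
  split=> //; apply: (long_function_equiv U0 (tail_near_gt0 Wf) _ Wb lU).
  by rewrite gt_eqF.
have VU : \forall x \near +oo, tail V x <= (a + b + 1) * tail U x.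
  by apply: (ratio_near_le U0 Va); lra.
have WU : \forall x \near +oo, tail W x <= (a + b + 1) * tail U x.
  by apply: (ratio_near_le U0 Wb); lra.
have C0 : 0 <= a + b + 1 by lra.
rewrite -[X in _ --> X]add0r.
have -> : (fun x => tail (convolution V W) x / tail U x) =
  (fun x => (tail (convolution V W) x - (tail V x + tail W x)) / tail U x +
    (tail V x / tail U x + tail W x / tail U x)).
  by apply/funext => x; rewrite -!mulrDl subrK.
by apply: cvgD; [exact: (one_big_jump lV lW sU C0 VU WU)|exact: cvgD].
Qed.

Lemma convolution_pow_equiv V U n :
  subexponential U -> long_function (tail U) -> halfline_full_tail V ->
  tail V x / tail U x @[x --> +oo] --> (1 : R) ->
  halfline_full_tail (convolution_pow V n.+1) /\
  tail (convolution_pow V n.+1) x / tail U x @[x --> +oo] --> (n.+1%:R : R).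
Proof.
move=> sU lU Vf VU; elim: n => [|n [IHf IH]]; first by [].
split; first exact: convolution_halfline_full.
rewrite -natr1 addrC.
by apply: tail_convolution_equiv => //; rewrite ltr0n.
Qed.

(** Both the powers of V and V itself are compared with the tail of U, and the
    quotient of the two limits is the degree of the power. *)
Lemma subexponential_equiv V U :
  subexponential U -> long_function (tail U) -> halfline_full_tail V ->
  tail V x / tail U x @[x --> +oo] --> (1 : R) -> subexponential V.
Proof.
move=> sU lU Vf VU; split=> // -[//|n] _.
have [_ VnU] := convolution_pow_equiv n sU lU Vf VU.
have U0 := tail_near_gt0 (proj1 sU).
have V0 := tail_near_gt0 Vf.
have lim : (tail (convolution_pow V n.+1) x / tail U x) / (tail V x / tail U x)
    @[x --> +oo] --> (n.+1%:R / 1 : R).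
  by apply: cvgM => //; apply: cvgV => //; exact: oner_neq0.
rewrite divr1 in lim; apply: cvg_trans lim; apply: near_eq_cvg; near=> x.
have ux : tail U x != 0 by rewrite gt_eqF//; near: x.
have vx : tail V x != 0 by rewrite gt_eqF//; near: x.
by field; rewrite ux vx.
Unshelve. all: by end_near. Qed.

(** The lower bound is the tail of the maximum of two independent variables of
    laws V and W.  The roles of U and U' are symmetric except for
    subexponentiality, and V * W is an admissible choice for either of them:
    this yields both directions of the main equivalence. *)
Lemma subexponential_sandwich V W U U' :
  long_tailed V -> long_tailed W ->
  U' `[0, +oo[%classic = 1%E ->
  (forall x, 0 <= x -> tail V x + tail W x - tail V x * tail W x <= tail U x
    <= tail (convolution V W) x) ->
  (forall x, 0 <= x -> tail V x + tail W x - tail V x * tail W x <= tail U' x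
    <= tail (convolution V W) x) ->
  subexponential U -> subexponential U'.
Proof.
move=> lV lW U'1 bU bU' sU.
have [[V1 V0] _] := lV; have [[W1 W0] _] := lW; have [[U1 U0] _] := sU.
have vwE x : tail V x <= tail V x + tail W x - tail V x * tail W x.
  rewrite -addrA lerDl -[X in X - _]mul1r -mulrBl mulr_ge0 ?tail_ge0//.
  by rewrite subr_ge0 tail_le1.
have wvE x : tail W x <= tail V x + tail W x - tail V x * tail W x.
  rewrite addrAC lerDr -[X in X - _]mulr1 -mulrBr mulr_ge0 ?tail_ge0//.
  by rewrite subr_ge0 tail_le1.
have VU x : 0 <= x -> tail V x <= tail U x.
  by move=> /bU/andP[+ _]; exact: le_trans.
have WU x : 0 <= x -> tail W x <= tail U x.
  by move=> /bU/andP[+ _]; exact: le_trans.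
have U'f : halfline_full_tail U'.
  split=> // x x0; apply: lt_le_trans (V0 _ x0) _.
  by apply: le_trans (vwE x) _; case/andP: (bU' _ x0).
pose G x := tail (convolution V W) x / tail U x.
pose H x := (tail V x + tail W x) / tail U x.
pose N x := tail V x * tail W x / tail U x.
have GH : (tail (convolution V W) x - (tail V x + tail W x)) / tail U x
    @[x --> +oo] --> (0 : R).
  apply: (one_big_jump lV lW sU ler01).
    by near=> x; rewrite mul1r VU//; near: x; apply: nbhs_pinfty_ge; exact: num_real.
  by near=> x; rewrite mul1r WU//; near: x; apply: nbhs_pinfty_ge; exact: num_real.
have N0 : N x @[x --> +oo] --> (0 : R).
  apply: (@squeeze_cvgr _ _ _ _ (cst 0) (tail W)); last exact: tail_cvg0.
    near=> x; have x0 : 0 <= x by near: x; apply: nbhs_pinfty_ge; exact: num_real.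
    rewrite /N divr_ge0 ?mulr_ge0 ?tail_ge0//= ler_pdivrMr ?U0// mulrC.
    by rewrite ler_wpM2l ?tail_ge0// VU.
  exact: cvg_cst.
(* The lower bound is at most u, and by the one big jump it differs from the
   upper bound G >= u by o(u) only. *)
have lo : (tail V x + tail W x - tail V x * tail W x) / tail U x
    @[x --> +oo] --> (1 : R).
  apply: (@squeeze_cvgr _ _ _ _ (fun x => 1 -
    ((tail (convolution V W) x - (tail V x + tail W x)) / tail U x + N x)) (cst 1)).
  - near=> x; have x0 : 0 <= x by near: x; apply: nbhs_pinfty_ge; exact: num_real.
    have ux := U0 _ x0; have /andP[b1 b2] := bU _ x0.
    rewrite /= [X in _ && X]ler_pdivrMr// mul1r b1 andbT.
    rewrite lerBlDr -!mulrDl ler_pdivlMr// mul1r; lra.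
  - rewrite -[X in _ --> X]subr0; apply: cvgB; first exact: cvg_cst.
    by rewrite -[X in _ --> X]addr0; exact: cvgD.
  - exact: cvg_cst.
have up : G x @[x --> +oo] --> (1 : R).
  have -> : G = fun x =>
      (tail V x + tail W x - tail V x * tail W x) / tail U x +
      ((tail (convolution V W) x - (tail V x + tail W x)) / tail U x + N x).
    by apply/funext => x; rewrite /G /N -!mulrDl; congr (_ / _); ring.
  rewrite -[X in _ --> X](addr0 1) -[X in 1 + X](addr0 0).
  by apply: cvgD => //; exact: cvgD.
have U'U : tail U' x / tail U x @[x --> +oo] --> (1 : R).
  apply: squeeze_cvgr lo up; near=> x.
  have x0 : 0 <= x by near: x; apply: nbhs_pinfty_ge; exact: num_real.
  have ux := U0 _ x0; have /andP[b1 b2] := bU' _ x0.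
  by rewrite /G !ler_pM2r ?invr_gt0// b1 b2.
have lU : long_function (tail U).
  have h0 : \forall x \near +oo, 0 < (tail V \+ tail W) x.
    near=> x; have x0 : 0 <= x by near: x; apply: nbhs_pinfty_ge; exact: num_real.
    by rewrite addr_gt0 ?V0 ?W0.
  have UH : tail U x / (tail V \+ tail W) x @[x --> +oo] --> (1 : R).
    have HU : H x @[x --> +oo] --> (1 : R).
      have -> : H = fun x =>
          (tail V x + tail W x - tail V x * tail W x) / tail U x + N x.
        by apply/funext => x; rewrite /H /N -mulrDl subrK.
      by rewrite -[X in _ --> X](addr0 1); exact: cvgD.
    rewrite -[X in _ --> X]invr1.
    rewrite (_ : (fun x => _) = (fun x => (H x)^-1)); last first.
      by apply/funext => x; rewrite /H invf_div.
    by apply: cvgV => //; exact: oner_neq0.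
  apply: (long_function_equiv h0 _ (oner_neq0 R) UH).
    exact: tail_near_gt0 (proj1 sU).
  exact: long_functionD V0 W0 (proj2 lV) (proj2 lW).
exact: (subexponential_equiv sU lU U'f U'U).
Unshelve. all: by end_near. Qed.

End closure.

(** * Subexponentiality of the sum of two random vectors *)

Theorem theorem3p4 (R : realType) (d : nat) (d_gt0 : (0 < d)%N)
    (A : rare_set R d)
    (d0 : measure_display) (Omega : measurableType d0)
    (P : probability Omega R) (X1 X2 : {RV P >-> 'rV[R]_d})
    (X1_ge0 : forall w, in_orthant (X1 w))
    (X2_ge0 : forall w, in_orthant (X2 w))
    (X12_indep : independent_rv X1 X2)
    (F1_long : class_at long_tailed A (distribution P X1))
    (F2_long : class_at long_tailed A (distribution P X2)) :
  subexponential
    (convolution (law_at A (distribution P X1)) (law_at A (distribution P X2))) <->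
  class_at subexponential A (distribution P (add_rv X1 X2)).
Proof.
rewrite /class_at /= in F1_long F2_long *.
set V := law_at A (distribution P X1) in F1_long *.
set W := law_at A (distribution P X2) in F2_long *.
set Z := law_at A (distribution P (add_rv X1 X2)).
have AR := rare_carP A.
have mY : measurable_fun setT (YA A) by exact: measurable_Yfun.
have mYB (B : set R) : measurable B -> measurable (YA A @^-1` B).
  by move=> mB; rewrite -[X in measurable X]setTI; exact: mY.
have indepY (B1 B2 : set R) : measurable B1 -> measurable B2 ->
    P ((YA A \o X1) @^-1` B1 `&` (YA A \o X2) @^-1` B2) = (V B1 * W B2)%E.
  by move=> /mYB mB1 /mYB mB2; exact: X12_indep mB1 mB2.
(* By independence, the pair of the two values of Y_A has law V \x W, so that
   its events can be compared pointwise with those of Y_A (X1 + X2). *)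
pose Y12 w := (YA A (X1 w), YA A (X2 w)).
have mY12 : measurable_fun setT Y12.
  by apply: measurable_fun_pair; apply: measurableT_comp => //.
have mY12B (B : set (R * R)) : measurable B -> measurable (Y12 @^-1` B).
  by move=> mB; rewrite -[X in measurable X]setTI; exact: mY12.
pose Y : {mfun Omega >-> (R * R)%type} :=
  HB.pack Y12 (isMeasurableFun.Build _ _ _ _ _ mY12).
have YE (B1 B2 : set R) : measurable B1 -> measurable B2 ->
    distribution P Y (B1 `*` B2) = (V B1 * W B2)%E.
  by move=> mB1 mB2; rewrite -indepY.
have mYi (X : {RV P >-> 'rV[R]_d}) x :
    measurable (X @^-1` (YA A @^-1` `]x, +oo[%classic)).
  rewrite -[X in measurable X]setTI; apply: (measurable_funPT X) => //.
  exact: mYB.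
have halfline (X : {RV P >-> 'rV[R]_d}) :
    law_at A (distribution P X) `[0, +oo[%classic = 1%E.
  rewrite -(probability_setT P); congr (P _).
  by apply/seteqP; split=> // w _; rewrite /= in_itv/= andbT Yfun_ge0.
have VWZ x : 0 <= x ->
    tail V x + tail W x - tail V x * tail W x <= tail Z x
    <= tail (convolution V W) x.
  move=> x0; apply/andP; split.
    rewrite -lee_fin tailE -(product_max_gt (halfline X1) (halfline X2) x0).
    rewrite (product_measure_unique YE); last exact: measurable_max_gt.
    rewrite -[leLHS]/(P (Y12 @^-1` max_gt x)).
    rewrite -[leRHS]/(P (add_rv X1 X2 @^-1` (YA A @^-1` `]x, +oo[%classic))).
    apply: le_measure; rewrite ?inE.
    - by apply: mY12B; exact: measurable_max_gt.
    - exact: mYi.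
    move=> w [_ _]; rewrite /= in_itv/= andbT lt_max => /orP[|] xY.
      exact: lt_le_trans xY (Yfun_monotone _ AR (X2_ge0 w)).
    rewrite /add_rv addrC.
    exact: lt_le_trans xY (Yfun_monotone _ AR (X1_ge0 w)).
  rewrite -lee_fin tailE tail_convolutionE.
  rewrite (product_measure_unique YE); last exact: measurable_sum_gt.
  rewrite -[leRHS]/(P (Y12 @^-1` sum_gt x)).
  rewrite -[leLHS]/(P (add_rv X1 X2 @^-1` (YA A @^-1` `]x, +oo[%classic))).
  apply: le_measure; rewrite ?inE.
  - exact: mYi.
  - by apply: mY12B; exact: measurable_sum_gt.
  move=> w; rewrite /= in_itv/= andbT /sum_gt /= => xZ.
  exact: lt_le_trans xZ (Yfun_subadditive _ _ AR).
have lo := tail_convolution_ge (halfline X1) (halfline X2).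
have self x : 0 <= x -> tail V x + tail W x - tail V x * tail W x
    <= tail (convolution V W) x <= tail (convolution V W) x.
  by move=> x0; rewrite lexx andbT; exact: lo.
split.
  exact: (subexponential_sandwich F1_long F2_long (halfline _) self VWZ).
apply: (subexponential_sandwich F1_long F2_long _ VWZ self).
by have [] := convolution_halfline_full (proj1 F1_long) (proj1 F2_long).
Qed.
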